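(* Let $(\mathfrak g,[\cdot,\cdot,\cdot]_{\mathfrak g})$ be a finite-dimensional real $3$-Lie algebra. Then there is a strict complex structure on $\mathfrak g$ if and only if its complexification $\mathfrak g_{\mathbb C}$ admits a decomposition $\mathfrak g_{\mathbb C}=\mathfrak q\oplus\mathfrak p$ (direct sum of vector spaces), where $\mathfrak q$ and $\mathfrak p=\sigma(\mathfrak q)$ are complex subalgebras of $\mathfrak g_{\mathbb C}$ such that $[\mathfrak q,\mathfrak q,\mathfrak p]_{\mathfrak g_{\mathbb C}}=0$ and $[\mathfrak p,\mathfrak p,\mathfrak q]_{\mathfrak g_{\mathbb C}}=0$, i.e. $\mathfrak g_{\mathbb C}$ is the $3$-Lie algebra direct sum of $\mathfrak q$ and $\mathfrak p$.
   Context: A $3$-Lie algebra is a vector space $\mathfrak g$ with a trilinear skew-symmetric bracket $[\cdot,\cdot,\cdot]_{\mathfrak g}$ satisfying $[x,y,[z,w,v]]=[[x,y,z],w,v]+[z,[x,y,w],v]+[z,w,[x,y,v]]$. The complexification $\mathfrak g_{\mathbb C}=\mathfrak g\otimes_{\mathbb R}\mathbb C=\{x+iy\mid x,y\in\mathfrak g\}$ is a complex $3$-Lie algebra with the complex-trilinear extension $[\cdot,\cdot,\cdot]_{\mathfrak g_{\mathbb C}}$ of the bracket; $\sigma(x+iy)=x-iy$ ($x,y\in\mathfrak g$) is the conjugation of $\mathfrak g_{\mathbb C}$ with respect to $\mathfrak g$. An almost complex structure on $\mathfrak g$ is a linear map $J:\mathfrak g\to\mathfrak g$ with $J^2=-\mathrm{Id}$.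 It is called a strict complex structure if $J[x,y,z]_{\mathfrak g}=[Jx,y,z]_{\mathfrak g}$ for all $x,y,z\in\mathfrak g$. *)

(* Defs.v *)
From HB Require Import structures.
From mathcomp Require Import all_boot all_order all_algebra.
From mathcomp Require Import reals.
From mathcomp Require Import complex.
Set Implicit Arguments.
Unset Strict Implicit.
Unset Printing Implicit Defensive.
Import Order.TTheory GRing.Theory Num.Theory.
Local Open Scope ring_scope.
Local Open Scope complex_scope.

HB.mixin Record Lmodule_isLie3 (K : fieldType) V of GRing.Lmodule K V := {
  bracket3 : V -> V -> V -> V;
  bracket3_linear1 : forall y z, linear (fun x => bracket3 x y z);
  bracket3_linear2 : forall x z, linear (fun y => bracket3 x y z);
  bracket3_linear3 : forall x y, linear (fun z => bracket3 x y z);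
  bracket3_skew12 : forall x y z, bracket3 x y z = - bracket3 y x z;
  bracket3_skew23 : forall x y z, bracket3 x y z = - bracket3 x z y;
  bracket3_fundamental : forall x y z w v,
    bracket3 x y (bracket3 z w v) =
      bracket3 (bracket3 x y z) w v + bracket3 z (bracket3 x y w) v
      + bracket3 z w (bracket3 x y v)
}.

#[short(type="lie3AlgType")]
HB.structure Definition Lie3Algebra (K : fieldType) :=
  {V of GRing.Lmodule K V & Lmodule_isLie3 K V}.

#[short(type="finDimLie3AlgType")]
HB.structure Definition FinDimLie3Algebra (K : fieldType) :=
  {V of Vector K V & Lmodule_isLie3 K V}.

(* The pair (x, y) stands for x + i y. *)
Definition complexification (R : realType) (V : lmodType R) : Type :=
  (V * V)%type.

HB.instance Definition _ (R : realType) (V : lmodType R) :=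
  GRing.Zmodule.copy (complexification V) (V * V)%type.

Section Complexification.
Variables (R : realType) (V : lmodType R).
Local Notation VC := (complexification V).
Implicit Types (a b : R[i]) (u v : VC).

Definition sigma u : VC := (u.1, - u.2).

Definition cscale a u : VC :=
  (complex.Re a *: u.1 - complex.Im a *: u.2,
   complex.Re a *: u.2 + complex.Im a *: u.1).

Fact cscaleA a b u : cscale a (cscale b u) = cscale (a * b) u.
Proof.
case: a b u => [a a'] [b b'] [x y]; rewrite /cscale /=.
congr (_, _); rewrite !(scalerDr, scalerDl, scalerN, scaleNr, scalerA);
  rewrite ?opprD -!addrA; congr (_ + _); by rewrite addrA addrC.
Qed.

Fact cscale1 : left_id 1 cscale.
Proof. by case=> x y; rewrite /cscale /= !scale1r !scale0r subr0 addr0. Qed.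

Fact cscaleDr : right_distributive cscale +%R.
Proof.
move=> [a a'] [x y] [x' y']; rewrite /cscale /=.
by congr (_, _); rewrite /= !scalerDr ?opprD addrACA.
Qed.

Fact cscaleDl u : {morph cscale^~ u : a b / a + b}.
Proof.
move=> [a a'] [b b']; rewrite /cscale /=.
by congr (_, _); rewrite /= !scalerDl ?opprD addrACA.
Qed.

HB.instance Definition _ :=
  GRing.Zmodule_isLmodule.Build R[i] VC cscaleA cscale1 cscaleDr cscaleDl.

End Complexification.

Section ComplexificationVector.
Import VectorInternalTheory.
Variables (R : realType) (V : vectType R).
Local Notation VC := (complexification V).

Let toC (u : VC) : 'rV[R[i]]_(dim V) :=
  \row_j (v2r u.1 ord0 j +i* v2r u.2 ord0 j).
Let ofC (r : 'rV[R[i]]_(dim V)) : VC :=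
  (r2v (map_mx (@complex.Re R) r), r2v (map_mx (@complex.Im R) r)).

Fact complexification_vector : Vector.axiom (dim V) VC.
Proof.
exists toC.
  move=> [a a'] [x y] [x' y']; apply/rowP=> j; rewrite !mxE /=.
  rewrite !(linearD, linearB, linearZ) /= !mxE.
  by apply/eqP; rewrite eq_complex /= linearN mxE mulrN !eqxx.
exists ofC.
  case=> x y; rewrite /ofC /toC /=; congr (_, _); apply: (canLR v2rK);
  by apply/rowP=> j; rewrite !mxE.
by move=> r; apply/rowP=> j; rewrite !mxE /= !r2vK !mxE; case: (r _ _).
Qed.

HB.instance Definition _ :=
  Lmodule_hasFinDim.Build R[i] VC complexification_vector.

End ComplexificationVector.

Section ComplexificationLie3.
Variables (R : realType) (g : lie3AlgType R).
Local Notation gC := (complexification g).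
Implicit Types u v w : gC.

(* The expansion of [u.1 + i u.2, v.1 + i v.2, w.1 + i w.2] by trilinearity. *)
Definition cbracket u v w : gC :=
  (bracket3 u.1 v.1 w.1 - bracket3 u.1 v.2 w.2
     - bracket3 u.2 v.1 w.2 - bracket3 u.2 v.2 w.1,
   bracket3 u.2 v.1 w.1 + bracket3 u.1 v.2 w.1
     + bracket3 u.1 v.1 w.2 - bracket3 u.2 v.2 w.2).

Let cext (A B : g -> g) u : gC := (A u.1 - B u.2, A u.2 + B u.1).

Fact cext_linear (A B : g -> g) : linear A -> linear B -> linear (cext A B).
Proof.
move=> linA linB a u v.
have lin (f : g -> g) : linear f -> [/\ {morph f : x y / x + y},
    {morph f : x / - x} & forall b, {morph f : x / b *: x}].
  move=> linf; pose F := GRing.isLinear.Build _ _ _ _ f linf.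
  pose f' : {linear g -> g} := HB.pack f F.
  split=> [x y|x|b x].
  - exact: (linearD f').
  - exact: (linearN f').
  - exact: (linearZZ f').
have [AD AN AZ] := lin A linA; have [BD BN BZ] := lin B linB.
have -> : cext A B (a *: u + v) = cext A B (a *: u) + cext A B v.
  by rewrite /cext; congr (_, _); rewrite /= AD BD ?opprD addrACA.
congr (_ + _); case: a u => [a a'] [x y]; rewrite /cext; congr (_, _).
- rewrite /= AD AN BD !AZ !BZ !(scalerDr, scalerN) !opprD -!addrA.
  by congr (_ + _); rewrite addrA [RHS]addrC addrAC -addrA.
- rewrite /= AD BD BN !AZ !BZ !(scalerDr, scalerN) -!addrA.
  by congr (_ + _); rewrite addrA [RHS]addrC addrAC -addrA.
Qed.

Fact cbracket_skew12 u v w : cbracket u v w = - cbracket v u w.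
Proof.
rewrite /cbracket; congr (_, _); rewrite /= !opprD ?opprK.
- by rewrite (bracket3_skew12 u.1 v.1) (bracket3_skew12 u.1 v.2)
    (bracket3_skew12 u.2 v.1) (bracket3_skew12 u.2 v.2) !opprK (addrAC (- _)).
- rewrite (bracket3_skew12 u.1 v.1) (bracket3_skew12 u.1 v.2)
    (bracket3_skew12 u.2 v.1) (bracket3_skew12 u.2 v.2) !opprK.
  by rewrite (addrC (- bracket3 v.1 u.2 w.1)).
Qed.

Fact cbracket_skew23 u v w : cbracket u v w = - cbracket u w v.
Proof.
rewrite /cbracket; congr (_, _); rewrite /= !opprD ?opprK.
- rewrite (bracket3_skew23 _ v.1 w.1) (bracket3_skew23 _ v.2 w.2)
    (bracket3_skew23 _ v.1 w.2) (bracket3_skew23 _ v.2 w.1) !opprK.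
  by rewrite addrAC.
- rewrite (bracket3_skew23 _ v.1 w.1) (bracket3_skew23 _ v.2 w.2)
    (bracket3_skew23 _ v.1 w.2) (bracket3_skew23 _ v.2 w.1) !opprK.
  by rewrite (addrAC (- bracket3 u.2 w.1 v.1)).
Qed.

Fact cbracket_linear1 v w : linear (fun u => cbracket u v w).
Proof.
pose A x := bracket3 x v.1 w.1 - bracket3 x v.2 w.2.
pose B x := bracket3 x v.1 w.2 + bracket3 x v.2 w.1.
have linA : linear A.
  move=> a x y; rewrite /A (bracket3_linear1 v.1) (bracket3_linear1 v.2) /=.
  by rewrite opprD addrACA scalerBr.
have linB : linear B.
  move=> a x y; rewrite /B (bracket3_linear1 v.1) (bracket3_linear1 v.2) /=.
  by rewrite addrACA scalerDr.
have E u : cbracket u v w = cext A B u.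
  rewrite /cbracket /cext /A /B; congr (_, _); first by rewrite opprD !addrA.
  rewrite -!addrA; congr (_ + _); rewrite [RHS]addrC addrA.
  by rewrite [in RHS](addrC (bracket3 u.1 v.1 w.2)).
by move=> a u u'; rewrite !E; apply: cext_linear.
Qed.

Fact cbracket_linear2 u w : linear (fun v => cbracket u v w).
Proof.
move=> a v v'; rewrite cbracket_skew12 cbracket_linear1 opprD -scalerN.
by rewrite -!cbracket_skew12.
Qed.

Fact cbracket_linear3 u v : linear (fun w => cbracket u v w).
Proof.
move=> a w w'; rewrite cbracket_skew23 cbracket_linear2 opprD -scalerN.
by rewrite -!cbracket_skew23.
Qed.

Let inj (x : g) : gC := (x, 0).

Let linear_eq_inj (f h : gC -> gC) : linear f -> linear h ->
  (forall x, f (inj x) = h (inj x)) -> forall u, f u = h u.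
Proof.
move=> linf linh fh u.
have -> : u = 'i *: inj u.2 + inj u.1.
  case: u => x y; rewrite [X in X + _]/GRing.scale /= /cscale /inj.
  congr (_, _); rewrite /= ?scale0r ?scale1r ?scaler0 ?subr0 ?addr0 ?add0r //.
by rewrite linf linh !fh.
Qed.

Let linear_add (f h : gC -> gC) : linear f -> linear h ->
  linear (fun u => f u + h u).
Proof. by move=> lf lh a u v; rewrite lf lh scalerDr addrACA. Qed.

Let linear_comp (f h : gC -> gC) : linear f -> linear h ->
  linear (fun u => f (h u)).
Proof. by move=> lf lh a u v; rewrite lh lf. Qed.

Let cbracket_inj x y z :
  cbracket (inj x) (inj y) (inj z) = inj (bracket3 x y z).
Proof.
have l1 b c : bracket3 0 b c = 0 :> g.
  by have := bracket3_linear1 b c (-1) 0 (0 : g);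
     rewrite /= scaler0 addr0 scaleN1r addNr.
have l2 b c : bracket3 b 0 c = 0 :> g by rewrite bracket3_skew12 l1 oppr0.
have l3 b c : bracket3 b c 0 = 0 :> g by rewrite bracket3_skew23 l2 oppr0.
by rewrite /cbracket /inj /= !(l1, l2, l3) !subr0 !addr0.
Qed.

Fact cbracket_fundamental x y z w v :
  cbracket x y (cbracket z w v) =
    cbracket (cbracket x y z) w v + cbracket z (cbracket x y w) v
    + cbracket z w (cbracket x y v).
Proof.
have L1 := cbracket_linear1; have L2 := cbracket_linear2.
have L3 := cbracket_linear3.
move: x; apply: linear_eq_inj => [||x].
- exact: L1.
- apply: linear_add; [apply: linear_add|].
  + exact: (linear_comp (L1 w v) (L1 y z)).
  + exact: (linear_comp (L2 z v) (L1 y w)).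
  + exact: (linear_comp (L3 z w) (L1 y v)).
move: y; apply: linear_eq_inj => [||y].
- exact: L2.
- apply: linear_add; [apply: linear_add|].
  + exact: (linear_comp (L1 w v) (L2 (inj x) z)).
  + exact: (linear_comp (L2 z v) (L2 (inj x) w)).
  + exact: (linear_comp (L3 z w) (L2 (inj x) v)).
have Lxy := L3 (inj x) (inj y).
move: z; apply: linear_eq_inj => [||z].
- exact: (linear_comp Lxy (L1 w v)).
- apply: linear_add; [apply: linear_add|]; try exact: L1.
  exact: (linear_comp (L1 w v) Lxy).
move: w; apply: linear_eq_inj => [||w].
- exact: (linear_comp Lxy (L2 (inj z) v)).
- apply: linear_add; [apply: linear_add|]; try exact: L2.
  exact: (linear_comp (L2 (inj z) v) Lxy).
move: v; apply: linear_eq_inj => [||v].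
- exact: (linear_comp Lxy (L3 (inj z) (inj w))).
- apply: linear_add; [apply: linear_add|]; try exact: L3.
  exact: (linear_comp (L3 (inj z) (inj w)) Lxy).
rewrite !cbracket_inj bracket3_fundamental /inj.
by congr (_, _); rewrite /= !addr0.
Qed.

HB.instance Definition _ := Lmodule_isLie3.Build R[i] gC
  cbracket_linear1 cbracket_linear2 cbracket_linear3
  cbracket_skew12 cbracket_skew23 cbracket_fundamental.

End ComplexificationLie3.

HB.instance Definition _ (R : realType) (g : finDimLie3AlgType R) :=
  Lie3Algebra.on (complexification g).

Definition almost_complex_structure (R : realType) (g : finDimLie3AlgType R)
    (J : 'End(g)) : Prop :=
  (J \o J = - \1)%VF.

Definition strict_complex_structure (R : realType) (g : finDimLie3AlgType R)
    (J : 'End(g)) : Prop :=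
  almost_complex_structure J /\
  forall x y z : g, J (bracket3 x y z) = bracket3 (J x) y z.

Definition is_subalgebra (K : fieldType) (L : finDimLie3AlgType K)
    (U : {vspace L}) : Prop :=
  forall x y z, x \in U -> y \in U -> z \in U -> bracket3 x y z \in U.

Definition bracket3_vanishes (K : fieldType) (L : finDimLie3AlgType K)
    (U V W : {vspace L}) : Prop :=
  forall x y z, x \in U -> y \in V -> z \in W -> bracket3 x y z = 0.

(* p = sigma(q), stated pointwise: sigma is only conjugate-linear, so the image
   operator (f @: q)%VS of linear maps does not apply. *)
Definition is_sigma_image (R : realType) (g : finDimLie3AlgType R)
    (q p : {vspace complexification g}) : Prop :=
  forall u, u \in p <-> exists2 v, v \in q & u = sigma v.

(* Main.v *)
From HB Require Import structures.
Require Import Defs.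
From mathcomp Require Import all_boot all_order all_algebra.
From mathcomp Require Import reals complex.
Import GRing.Theory.
Local Open Scope ring_scope.

(** Write [u.1] and [u.2] for the real and imaginary parts of [u] in [gC].

    From [J] to the splitting: the complex-linear extension [JC] of [J] still
    satisfies [JC ^ 2 = -1], so [gC] is the direct sum of the eigenspaces [q]
    for [i] and [p] for [-i] ([eigenspaces_direct]), and [sigma] exchanges them
    because [JC] commutes with [sigma] ([eigenspaces_sigma]).  Strictness implies
    that a bracket whose first entry is an eigenvector of [JC] is an
    eigenvector for the same eigenvalue; skew-symmetry extends this to every
    entry.  So each eigenspace is a subalgebra, and a bracket with entries in
    both is an eigenvector for both [i] and [-i], that is, zero
    ([bracket3_eigenspaces_vanish]).

    From the splitting to [J]: taking real parts is a real-linear bijection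
    from [q] onto [g], since a real vector [x] decomposes along [q + p] as
    [a + sigma a] ([real_decomposition]).  The operator [J] is multiplication
    by [i] on [q] transported along this bijection, so it sends [a.1] to the
    real part [- a.2] of ['i *: a].  The mixed brackets vanish, so the
    bracket of [a + sigma a], [b + sigma b], [c + sigma c] is
    [d + sigma d] with [d] the bracket of [a], [b], [c] in [q]
    ([bracket3_real_parts]); strictness of [J] is then the complex linearity of
    the bracket of [q] in its first slot. *)

(** * Multilinearity of the bracket *)

Section Bracket.
Variables (K : fieldType) (L : lie3AlgType K).
Implicit Types x y z : L.

Lemma bracket3Dl x x' y z :
  bracket3 (x + x') y z = bracket3 x y z + bracket3 x' y z.
Proof. by have /= := bracket3_linear1 y z 1 x x'; rewrite !scale1r. Qed.

Lemma bracket3Dm x y y' z :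
  bracket3 x (y + y') z = bracket3 x y z + bracket3 x y' z.
Proof. by have /= := bracket3_linear2 x z 1 y y'; rewrite !scale1r. Qed.

Lemma bracket3Dr x y z z' :
  bracket3 x y (z + z') = bracket3 x y z + bracket3 x y z'.
Proof. by have /= := bracket3_linear3 x y 1 z z'; rewrite !scale1r. Qed.

Lemma bracket30l y z : bracket3 (0 : L) y z = 0.
Proof. by apply: (addrI (bracket3 0 y z)); rewrite -bracket3Dl !addr0. Qed.

Lemma bracket30m x z : bracket3 x (0 : L) z = 0.
Proof. by rewrite bracket3_skew12 bracket30l oppr0. Qed.

Lemma bracket30r x y : bracket3 x y (0 : L) = 0.
Proof. by rewrite bracket3_skew23 bracket30m oppr0. Qed.

Lemma bracket3Zl a x y z : bracket3 (a *: x) y z = a *: bracket3 x y z.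
Proof.
by have /= := bracket3_linear1 y z a x 0; rewrite bracket30l !addr0.
Qed.

Lemma bracket3Zm a x y z : bracket3 x (a *: y) z = a *: bracket3 x y z.
Proof.
by rewrite bracket3_skew12 bracket3Zl -scalerN -bracket3_skew12.
Qed.

Lemma bracket3Zr a x y z : bracket3 x y (a *: z) = a *: bracket3 x y z.
Proof.
by rewrite bracket3_skew23 bracket3Zm -scalerN -bracket3_skew23.
Qed.

Lemma bracket3Nl x y z : bracket3 (- x) y z = - bracket3 x y z.
Proof. by rewrite -scaleN1r bracket3Zl scaleN1r. Qed.

Lemma bracket3Nm x y z : bracket3 x (- y) z = - bracket3 x y z.
Proof. by rewrite -scaleN1r bracket3Zm scaleN1r. Qed.

Lemma bracket3Nr x y z : bracket3 x y (- z) = - bracket3 x y z.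
Proof. by rewrite -scaleN1r bracket3Zr scaleN1r. Qed.

End Bracket.

(** Skew-symmetry moves the vanishing of brackets with two entries in one
    subspace and one in the other to every position, which kills all six mixed
    terms of the expansion. *)
Lemma bracket3_direct {K : fieldType} {L : finDimLie3AlgType K}
    {q p : {vspace L}} {a a' b b' c c' : L} :
    bracket3_vanishes q q p -> bracket3_vanishes p p q ->
    a \in q -> b \in q -> c \in q -> a' \in p -> b' \in p -> c' \in p ->
  bracket3 (a + a') (b + b') (c + c') = bracket3 a b c + bracket3 a' b' c'.
Proof.
move=> qqp ppq aq bq cq a'p b'p c'p.
rewrite !(bracket3Dl, bracket3Dm, bracket3Dr).
rewrite (qqp a b c') // (ppq a' b' c) //.
rewrite (bracket3_skew23 a b' c) (qqp a c b') //.
rewrite (bracket3_skew23 a' b c') (ppq a' c' b) //.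
rewrite (bracket3_skew12 a b' c') (bracket3_skew23 b' a) (ppq b' c' a) //.
rewrite (bracket3_skew12 a' b c) (bracket3_skew23 b a') (qqp b c a') //.
by rewrite !oppr0 !(addr0, add0r).
Qed.

(** * Real and imaginary parts *)

Section Complexification.
Variables (R : realType) (g : finDimLie3AlgType R).
Local Notation gC := (complexification g).
Implicit Types u v w : gC.

Lemma complexificationP u v : u.1 = v.1 -> u.2 = v.2 -> u = v.
Proof. by case: u v => [x y] [x' y'] /= -> ->. Qed.

Lemma i_neq_opp : 'i != - 'i :> R[i].
Proof.
rewrite -addr_eq0 -mulr2n -mulr_natl mulf_neq0 ?Num.Theory.neq0Ci //.
by rewrite Num.Theory.pnatr_eq0.
Qed.

Lemma scaleiE u : 'i *: u = (- u.2, u.1) :> gC.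
Proof.
by apply: complexificationP; rewrite /= ?scale0r ?scale1r ?sub0r ?add0r.
Qed.

Lemma scaleii u : 'i *: ('i *: u) = - u :> gC.
Proof. by rewrite scalerA -expr2 sqr_i scaleN1r. Qed.

Lemma scale_real (a : R) u : a%:C%C *: u = (a *: u.1, a *: u.2) :> gC.
Proof.
by apply: complexificationP; rewrite /= scale0r ?subr0 ?addr0.
Qed.

Lemma sigmaK : involutive (@sigma R g).
Proof. by move=> [x y]; rewrite /sigma /= opprK. Qed.

Lemma sigma_bracket u v w :
  sigma (bracket3 u v w) = bracket3 (sigma u) (sigma v) (sigma w).
Proof.
apply: complexificationP; rewrite /= !(bracket3Nl, bracket3Nm, bracket3Nr).
  by rewrite !opprK.
by rewrite !opprD !opprK.
Qed.

Lemma sigmaD u v : sigma (u + v) = sigma u + sigma v.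
Proof. by apply: complexificationP; rewrite /= ?opprD. Qed.

Lemma sigmai u : sigma ('i *: u) = - 'i *: sigma u.
Proof.
by rewrite scaleNr !scaleiE; apply: complexificationP; rewrite /= ?opprK.
Qed.

Lemma sigmaNi u : sigma (- 'i *: u) = 'i *: sigma u.
Proof. by rewrite -[in LHS](sigmaK u) -sigmai sigmaK. Qed.

End Complexification.
Arguments scaleiE {R g} u.

(** * Eigenspaces of operators that commute with the bracket *)

Import passmx(leigenspace).

Lemma leigenspaceP {K : fieldType} {V : vectType K} {f : 'End(V)} {a : K}
    {x : V} : reflect (f x = a *: x) (x \in leigenspace f a).
Proof.
by apply: (iffP eqlfunP); rewrite scale_lfunE id_lfunE.
Qed.

Lemma bracket3_eigenspace {K : fieldType} {L : finDimLie3AlgType K}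
    {f : 'End(L)} {a : K} {x y z : L} :
    (forall x y z, f (bracket3 x y z) = bracket3 (f x) y z) ->
  x \in leigenspace f a -> bracket3 x y z \in leigenspace f a.
Proof.
by move=> fl /leigenspaceP fx; apply/leigenspaceP; rewrite fl fx bracket3Zl.
Qed.

Lemma leigenspace_disjoint {K : fieldType} {V : vectType K}
    {f : 'End(V)} {a b : K} {x : V} :
  a != b -> x \in leigenspace f a -> x \in leigenspace f b -> x = 0.
Proof.
move=> neq_ab /leigenspaceP fx /leigenspaceP; rewrite fx => /eqP.
by rewrite -subr_eq0 -scalerBl scaler_eq0 subr_eq0 (negPf neq_ab) => /eqP.
Qed.

(** The bracket lies in the eigenspace of its first entry and, by
    skew-symmetry, in that of its third. *)
Lemma bracket3_eigenspaces_vanish {K : fieldType} {L : finDimLie3AlgType K}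
    {f : 'End(L)} {a b : K} :
    (forall x y z, f (bracket3 x y z) = bracket3 (f x) y z) -> a != b ->
  bracket3_vanishes (leigenspace f a) (leigenspace f a) (leigenspace f b).
Proof.
move=> fl neq_ab x y z fx _ fz; apply: (leigenspace_disjoint neq_ab).
  exact: (bracket3_eigenspace fl fx).
by rewrite bracket3_skew23 bracket3_skew12 opprK (bracket3_eigenspace fl fz).
Qed.

(** * From a strict complex structure to a splitting *)

Section Splitting.
Variables (R : realType) (g : finDimLie3AlgType R) (J : 'End(g)).
Local Notation gC := (complexification g).

Definition cextension (u : gC) : gC := (J u.1, J u.2).

Fact cextension_linear : linear cextension.
Proof.
by move=> a u v; apply: complexificationP;
  rewrite /= !(linearD, linearN, linearZ).
Qed.

HB.instance Definition _ :=
  GRing.isLinear.Build R[i] gC gC _ cextension cextension_linear.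

Let JC : 'End(gC) := linfun cextension.
Let q := leigenspace JC 'i.
Let p := leigenspace JC (- 'i).

Let JCE u : JC u = (J u.1, J u.2). Proof. exact: lfunE. Qed.

Lemma cextension_strict :
    (forall x y z : g, J (bracket3 x y z) = bracket3 (J x) y z) ->
  forall u v w, JC (bracket3 u v w) = bracket3 (JC u) v w.
Proof.
by move=> Jl u v w; rewrite !JCE; apply: complexificationP;
  rewrite /= !(linearD, linearN) /= !Jl.
Qed.

Let JC_sigma u : JC (sigma u) = sigma (JC u).
Proof. by rewrite !JCE /sigma /= linearN. Qed.

Lemma eigenspaces_sigma : is_sigma_image q p.
Proof.
move=> u; split=> [/leigenspaceP pu | [v /leigenspaceP qv ->]].
  exists (sigma u); last by rewrite sigmaK.
  by apply/leigenspaceP; rewrite JC_sigma pu sigmaNi.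
by apply/leigenspaceP; rewrite JC_sigma qv sigmai.
Qed.

(** As [JC] squares to [-1], half of [u - i JC u] lies in [q] and half of
    [u + i JC u] in [p]. *)
Lemma eigenspaces_direct : almost_complex_structure J ->
  (q + p)%VS = fullv /\ directv (q + p).
Proof.
move=> Jsq.
have JJ u : JC (JC u) = - u.
  have Jx x : J (J x) = - x by rewrite -comp_lfunE Jsq opp_lfunE id_lfunE.
  by rewrite !JCE /= !Jx.
split; last first.
  apply/directv_addP/eqP; rewrite -subv0; apply/subvP=> u /memv_capP[qu pu].
  by rewrite (leigenspace_disjoint (i_neq_opp R) qu pu) mem0v.
apply/eqP; rewrite eqEsubv subvf; apply/subvP=> u _.
have -> : u = 2^-1 *: (u - 'i *: JC u) + 2^-1 *: (u + 'i *: JC u).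
  rewrite -scalerDr addrACA addNr addr0 -mulr2n -[u *+ 2]scaler_nat scalerA.
  by rewrite mulVf ?scale1r // Num.Theory.pnatr_eq0.
apply: memv_add; apply/memvZ/leigenspaceP.
  by rewrite linearB linearZ /= JJ scalerBr scaleii scalerN !opprK addrC.
rewrite linearD linearZ /= JJ !scaleNr scalerDr scaleii.
by rewrite scalerN opprD opprK addrC.
Qed.

End Splitting.
Arguments cextension {R g} J u.
Arguments cextension_strict {R g J}.

(** * From a splitting to a strict complex structure *)

Section RealParts.
Variables (R : realType) (g : finDimLie3AlgType R).
Local Notation gC := (complexification g).
Variables q p : {vspace gC}.
Hypotheses (qp_full : (q + p)%VS = fullv) (qp_direct : directv (q + p)).
Hypothesis p_sigma : is_sigma_image q p.

Let sigma_p {a} : a \in q -> sigma a \in p.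
Proof. by move=> qa; apply/p_sigma; exists a. Qed.

Let sigma_q {b} : b \in p -> sigma b \in q.
Proof. by move/p_sigma=> [a qa ->]; rewrite sigmaK. Qed.

Lemma add_sigma (a : gC) : a + sigma a = (a.1 + a.1, 0).
Proof. by apply: complexificationP; rewrite /= ?subrr. Qed.

(** The components of [(x, 0)] are exchanged by [sigma], because it fixes
    [(x, 0)] and exchanges [q] and [p]. *)
Lemma real_decomposition (x : g) : exists2 a, a \in q & x = a.1 + a.1.
Proof.
have /memv_addP[a qa [b pb Eab]] : ((x, 0) : gC) \in (q + p)%VS.
  by rewrite qp_full memvf.
have := Eab; have -> : b = sigma a.
  have /eqP : a + b = sigma b + sigma a.
    by rewrite -Eab [RHS]addrC -sigmaD -Eab /sigma oppr0.
  rewrite (directv_add_unique qp_direct) ?sigma_q ?sigma_p //.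
  by case/eqP.
by rewrite add_sigma => -[->]; exists a.
Qed.

(** If [(x, 0) = a + sigma a] then ['i *: a + sigma ('i *: a)] is the real
    vector [- (a.2 + a.2)]: this is multiplication by [i] on [q], seen on real
    parts. *)
Definition real_J (x : g) : g :=
  let a := daddv_pi q p (x, 0) in - (a.2 + a.2).

Fact real_J_linear : linear real_J.
Proof.
move=> a x y; rewrite /real_J.
have -> : (a *: x + y, 0) = a%:C%C *: ((x, 0) : gC) + (y, 0) :> gC.
  by rewrite scale_real; apply: complexificationP; rewrite /= ?scaler0 ?addr0.
have -> u v : daddv_pi q p (a%:C%C *: u + v) =
    (a *: (daddv_pi q p u).1, a *: (daddv_pi q p u).2) + daddv_pi q p v.
  by rewrite -scale_real; apply: linearP.
rewrite /= scalerN scalerDr -opprD.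
by rewrite addrACA.
Qed.

HB.instance Definition _ := GRing.isLinear.Build R g g _ real_J real_J_linear.

Lemma real_J_real_part a : a \in q -> real_J (a.1 + a.1) = - (a.2 + a.2).
Proof.
move=> qa; rewrite /real_J -add_sigma.
have qp0 : (q :&: p = 0)%VS by apply/directv_addP.
have -> : daddv_pi q p (a + sigma a) = a + daddv_pi q p (sigma a).
  by rewrite [LHS]linearD /= daddv_pi_id.
have -> : daddv_pi q p (sigma a) = 0.
  apply: (addIr (daddv_pi p q (sigma a))); rewrite daddv_pi_add ?add0r //.
    by rewrite daddv_pi_id ?sigma_p // capvC.
  by rewrite qp_full memvf.
by rewrite addr0.
Qed.

Lemma real_J_almost_complex : almost_complex_structure (linfun real_J).
Proof.
apply/lfunP=> x; rewrite comp_lfunE opp_lfunE id_lfunE !lfunE /=.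
have [a qa ->] := real_decomposition x; rewrite real_J_real_part //.
(* The real vector with [q]-component ['i *: a]. *)
have -> : - (a.2 + a.2) = ('i *: a).1 + ('i *: a).1.
  by rewrite scaleiE opprD.
by rewrite real_J_real_part ?memvZ // scaleiE.
Qed.

Hypotheses (q_sub : is_subalgebra q).
Hypotheses (qqp : bracket3_vanishes q q p) (ppq : bracket3_vanishes p p q).

(** Taking real parts is a bracket morphism up to a factor: the mixed brackets
    vanish, and the two remaining ones are exchanged by [sigma], so they have
    the same real part. *)
Lemma bracket3_real_parts a b c : a \in q -> b \in q -> c \in q ->
  bracket3 (a.1 + a.1) (b.1 + b.1) (c.1 + c.1) =
    (bracket3 a b c).1 + (bracket3 a b c).1.
Proof.
move=> qa qb qc.
have /(congr1 fst) := bracket3_direct qqp ppq qa qb qc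
  (sigma_p qa) (sigma_p qb) (sigma_p qc).
rewrite -sigma_bracket !add_sigma /= => <-.
by rewrite !(bracket30l, bracket30m, bracket30r) !subr0.
Qed.

Lemma real_J_strict : strict_complex_structure (linfun real_J).
Proof.
split=> [|x y z]; first exact: real_J_almost_complex.
rewrite !lfunE /=.
have [a qa ->] := real_decomposition x; have [b qb ->] := real_decomposition y.
have [c qc ->] := real_decomposition z.
rewrite bracket3_real_parts // !real_J_real_part ?q_sub //.
have -> : - (a.2 + a.2) = ('i *: a).1 + ('i *: a).1.
  by rewrite scaleiE opprD.
by rewrite bracket3_real_parts ?memvZ // bracket3Zl scaleiE opprD.
Qed.

End RealParts.
Arguments real_J {R g} q p x.

Theorem corollary6p7 (R : realType) (g : finDimLie3AlgType R) :
  (exists J : 'End(g), strict_complex_structure J) <->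
  (exists q p : {vspace complexification g},
    [/\ (q + p)%VS = fullv /\ directv (q + p),
        is_sigma_image q p,
        is_subalgebra q /\ is_subalgebra p,
        bracket3_vanishes q q p
      & bracket3_vanishes p p q]).
Proof.
split=> [[J [Jsq Jl]] | [q [p [[full dir] sig [qsub _] qqp ppq]]]].
  have JCl := cextension_strict Jl.
  exists (leigenspace (linfun (cextension J)) 'i).
  exists (leigenspace (linfun (cextension J)) (- 'i)).
  split.
  - exact: eigenspaces_direct.
  - exact: eigenspaces_sigma.
  - by split=> x y z qx _ _; apply: (bracket3_eigenspace JCl qx).
  - by apply: (bracket3_eigenspaces_vanish JCl); rewrite i_neq_opp.
  - by apply: (bracket3_eigenspaces_vanish JCl); rewrite eq_sym i_neq_opp.
by exists (linfun (real_J q p)); apply: real_J_strict.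
Qed.
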